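(* Consider the scalar ODE model $\dot X = f(X) + g(X;\boldsymbol p)$, where $f:\mathbb{R}\to\mathbb{R}$ is an unknown function and $g(\cdot\,;\boldsymbol p):\mathbb{R}\to\mathbb{R}$ is a known functional form depending on a vector $\boldsymbol p$ of unknown scalar parameters with $|\boldsymbol p|>0$ (at least one unknown parameter is present). The state $X$ is observed. Then the unknown function $f$ is structurally non-identifiable. Specifically, given any admissible pair $(f_1,\boldsymbol p_1)$, any pair $(f_2,\boldsymbol p_2)$ of the form $$\boldsymbol p_2\in\mathbb{R}^{|\boldsymbol p|},\qquad f_2(X)=f_1(X)+g(X;\boldsymbol p_1)-g(X;\boldsymbol p_2),$$ yields identical dynamics to $(f_1,\boldsymbol p_1)$.
   Context: An ODE model has the form $\dot{\boldsymbol X}(t)=\boldsymbol F(\boldsymbol X;\boldsymbol f,\boldsymbol p)$, $\boldsymbol Y(t)=\boldsymbol H(\boldsymbol X(t))$, with state $\boldsymbol X\in\mathbb{R}^n$, observed output $\boldsymbol Y$ consisting of some or all of the state variables, known $\boldsymbol F,\boldsymbol H$, a vector $\boldsymbol p$ of unknown scalar parameters, and unknown real-valued functions $\boldsymbol f=(f_1,\dots,f_k)$, where $f_j:\mathcal U_j\to\mathbb{R}$ depends on a subset of the state variables. $|\boldsymbol p|$ denotes the number of components of $\boldsymbol p$. A choice of unknowns is admissible if it is a possible choice of functions and parameters for the model. Two choices $(\boldsymbol f_1,\boldsymbol p_1)$ and $(\boldsymbol f_2,\boldsymbol p_2)$ give the same observed outputs (''yield identical dynamics'') if they produce the same output trajectory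 $\boldsymbol Y(t)$ for every initial condition consistent with prior knowledge of the initial conditions (here: $\boldsymbol Y(0)$ is known). Fix a generic choice $(\boldsymbol f_1,\boldsymbol p_1)$. An unknown function $f_j$ is globally structurally identifiable (or simply structurally identifiable) if every choice $(\boldsymbol f_2,\boldsymbol p_2)$ giving the same observed outputs as $(\boldsymbol f_1,\boldsymbol p_1)$ has $f_{1,j}=f_{2,j}$; locally structurally identifiable if there is $\varepsilon>0$ such that every choice $(\boldsymbol f_2,\boldsymbol p_2)$ giving the same observed outputs and satisfying $\sup_{\boldsymbol u\in\mathcal U_j}|f_{1,j}(\boldsymbol u)-f_{2,j}(\boldsymbol u)|<\varepsilon$ has $f_{1,j}=f_{2,j}$; structurally non-identifiable otherwise. Unless otherwise mentioned, ''structurally identifiable'' means globally structurally identifiable and ''non-identifiable'' is its failure through infinitely many alternatives.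
   Formalization: Non-identifiability of f (infinitely many alternative functions) is proved if the family g(·;p) is infinite, or g is non-constant and continuous in p (it fails e.g. for g=1 if p≠0, else 0), and if every compensating pair (f2,p2) is admissible; failure of local identifiability if g is sup-continuous in p. *)

(* Defs.v *)
From HB Require Import structures.
From mathcomp Require Import all_boot all_order all_algebra.
From mathcomp Require Import all_classical all_reals all_analysis.

Set Implicit Arguments.
Unset Strict Implicit.
Unset Printing Implicit Defensive.

Import Order.TTheory GRing.Theory Num.Theory.
Import numFieldNormedType.Exports.

Local Open Scope classical_set_scope.
Local Open Scope ring_scope.

Section ScalarModel.
Variables (R : realType) (m : nat).

(* [g x p] is g(x; p), with p a vector of m real parameters. *)
Variable g : R -> 'rV[R]_m -> R.

Definition rhs (f : R -> R) (p : 'rV[R]_m) (x : R) : R := f x + g x p.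

(* X solves X' = F(X), X(0) = x0, on the time interval [0, T[, with T
   possibly +oo.  The limit of difference quotients over nonnegative times is
   the ordinary derivative for t > 0 and the right derivative for t = 0.
   Values of X outside [0, T[ are irrelevant. *)
Definition solves (F : R -> R) (x0 : R) (T : \bar R) (X : R -> R) : Prop :=
  X 0 = x0 /\
  forall t : R, 0 <= t -> (t%:E < T)%E ->
    (fun s => (X s - X t) / (s - t)) @ within [set s | 0 <= s] t^'
      --> F (X t).

(* The state is observed, so the output trajectory Y is X itself. *)
Definition outputs (f : R -> R) (p : 'rV[R]_m) (x0 : R) (T : \bar R) :
    set (R -> R) :=
  [set Y | solves (rhs f p) x0 T Y].

(* Y(0) = X(0) is known, so both choices start from the same x0.  No
   regularity is imposed, hence the comparison of sets of trajectories: when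
   solutions are unique, this is equality of the two trajectories and of their
   intervals of existence. *)
Definition same_outputs (f1 : R -> R) (p1 : 'rV[R]_m)
    (f2 : R -> R) (p2 : 'rV[R]_m) : Prop :=
  forall (x0 : R) (T : \bar R), (0 < T)%E ->
    outputs f1 p1 x0 T = outputs f2 p2 x0 T.

(* The admissible choices of the unknowns (f, p). *)
Variable adm : (R -> R) -> 'rV[R]_m -> Prop.

Definition globally_identifiable (f1 : R -> R) (p1 : 'rV[R]_m) : Prop :=
  forall f2 p2, adm f2 p2 -> same_outputs f1 p1 f2 p2 -> f1 = f2.

Definition locally_identifiable (f1 : R -> R) (p1 : 'rV[R]_m) : Prop :=
  exists2 eps : R, 0 < eps &
    forall f2 p2, adm f2 p2 -> same_outputs f1 p1 f2 p2 ->
      (ereal_sup (range (fun x => `|f1 x - f2 x|%:E)) < eps%:E)%E -> f1 = f2.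

(* Failure of global identifiability of f through infinitely many alternative
   functions. *)
Definition nonidentifiable (f1 : R -> R) (p1 : 'rV[R]_m) : Prop :=
  infinite_set [set f2 : R -> R |
    f2 <> f1 /\ exists2 p2, adm f2 p2 & same_outputs f1 p1 f2 p2].

Definition compensate (f1 : R -> R) (p1 p2 : 'rV[R]_m) (x : R) : R :=
  f1 x + g x p1 - g x p2.

(* Every parameter value p2 may be chosen, together with the function that
   compensates for it. *)
Definition compensation_closed : Prop :=
  forall f1 p1 p2, adm f1 p1 -> adm (compensate f1 p1 p2) p2.

Definition depends_on_parameters : Prop :=
  exists p q : 'rV[R]_m, g^~ p <> g^~ q.

(* Continuity of p |-> g(.; p) for the sup distance on functions R -> R. *)
Definition sup_continuous_in_parameters : Prop :=
  forall (p : 'rV[R]_m) (eps : R), 0 < eps ->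
    \forall q \near p, forall x, `|g x q - g x p| < eps.

End ScalarModel.

(* Main.v *)
Require Import Defs.
From HB Require Import structures.
From mathcomp Require Import all_boot all_order all_algebra.
From mathcomp Require Import all_classical all_reals all_analysis.

(** Compensation leaves the right-hand side f + g(.; p) unchanged, hence also
    the set of solutions. Every alternative function obtained in this way is
    f1 + g(.; p1) - g(.; q), so f has as many of them as there are functions
    g(.; q). If g is continuous in the parameters, an evaluation g(x; q) that
    takes two values takes a whole interval of them, as R^m is connected.
    Connectedness also yields alternatives that are close to f1 but different
    from it, even if g(.; q) is constant for q near p1: otherwise
    [{q | g(.; q) = g(.; p1)}] would be open, closed and nonempty, that is, all
    of R^m. *)

Set Implicit Arguments.
Unset Strict Implicit.
Unset Printing Implicit Defensive.

Import Order.TTheory GRing.Theory Num.Theory.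
Import numFieldNormedType.Exports.

Local Open Scope classical_set_scope.
Local Open Scope ring_scope.

(** The segments from 0 to [v] cover the space; each is a continuous image of [0, 1], and they all
    share the point 0. *)
Lemma normed_module_connected (R : realType) (V : normedModType R) :
  connected [set: V].
Proof.
have -> : [set: V] = \bigcup_(v : V) ((fun t : R => t *: v) @` `[0, 1]).
  apply/esym/seteqP; split => // v _; exists v => //; exists 1.
    by rewrite /= in_itv /= ler01 lexx.
  by rewrite scale1r.
apply: bigcup_connected.
  exists 0 => v _; exists 0; last by rewrite scale0r.
  by rewrite /= in_itv /= ler01 lexx.
move=> v _; apply: connected_continuous_connected.
  exact: segment_connected.
by apply: continuous_subspaceT => t; exact: scalel_continuous.
Qed.

Lemma infinite_is_interval (R : realType) (A : set R) (a b : R) :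
  is_interval A -> A a -> A b -> a < b -> infinite_set A.
Proof.
move=> iA Aa Ab ab finA.
(* These points are pairwise distinct and stay in ]a, b], with [u 0 = b]. *)
pose u (n : nat) : R := a + (b - a) / n.+1%:R.
have ba0 : 0 < b - a by rewrite subr_gt0.
have u_inj : injective u.
  move=> i j /addrI /(mulfI (lt0r_neq0 ba0)) /invr_inj /eqP.
  by rewrite eqr_nat eqSS => /eqP.
apply: infinite_nat; apply: sub_finite_set (finite_preimage (f := u) _ finA).
  move=> n _; apply: (iA a b) => //; apply/andP; split.
    by rewrite lerDl divr_ge0 // ltW.
  by rewrite -[leRHS](subrKC a) lerD2l ler_pdivrMr // ler_peMr ?ler1n // ltW.
by move=> i j _ _; exact: u_inj.
Qed.

Lemma infinite_range_continuous (R : realType) (V : normedModType R)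
    (h : V -> R) (v w : V) :
  continuous h -> h v != h w -> infinite_set (range h).
Proof.
move=> h_cont; wlog hvw : v w / h v < h w => [wlog_lt|_].
  by rewrite neq_lt => /orP[] hvw; apply: (wlog_lt _ _ hvw);
    rewrite ?(lt_eqF hvw).
apply: (infinite_is_interval _ _ _ hvw); [|by exists v|by exists w].
apply/connected_intervalP/connected_continuous_connected.
  exact: normed_module_connected.
exact: continuous_subspaceT.
Qed.

Lemma infinite_row_space (R : realType) (m : nat) :
  (0 < m)%N -> infinite_set [set: 'rV[R]_m].
Proof.
case: m => // m _ finT; apply: infinite_nat.
(* The constant rows n, for n natural, are told apart by their entry at [ord0], which exists since m
   > 0. *)
apply: sub_finite_set (finite_preimage (f := fun n => const_mx n%:R) _ finT).
  by [].
by move=> i j _ _ /rowP/(_ ord0); rewrite !mxE => /eqP; rewrite eqr_nat => /eqP.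
Qed.

Section Compensation.
Variables (R : realType) (m : nat) (g : R -> 'rV[R]_m -> R).

Lemma same_outputs_compensation (f1 f2 : R -> R) (p1 p2 : 'rV[R]_m) :
  (forall x, f2 x = f1 x + g x p1 - g x p2) -> same_outputs g f1 p1 f2 p2.
Proof.
move=> f2E x0 T _; rewrite /outputs; suff -> : rhs g f2 p2 = rhs g f1 p1 by [].
by apply/funext => x; rewrite /rhs f2E subrK.
Qed.

(** Turns the conclusion [f1 = f2] of an identifiability property into a statement about [g]
    alone. *)
Lemma compensate_eq (f1 : R -> R) (p1 p2 : 'rV[R]_m) :
  f1 = compensate g f1 p1 p2 -> g^~ p2 = g^~ p1.
Proof.
move=> /funeqP fE; apply/funext => x; move/esym/eqP: (fE x).
by rewrite /compensate -addrA -[eqbRHS]addr0 (inj_eq (addrI _)) subr_eq0 => /eqP.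
Qed.

Variable adm : (R -> R) -> 'rV[R]_m -> Prop.
Hypothesis adm_comp : compensation_closed g adm.

Lemma same_outputs_compensate (f : R -> R) (p q : 'rV[R]_m) :
  same_outputs g f p (compensate g f p q) q.
Proof. exact: same_outputs_compensation. Qed.

(** Pairs are counted here, and they project onto all of R^m because each [q] comes with its
    compensating function; nothing is asked of [g]. *)
Lemma infinite_choices (f1 : R -> R) (p1 : 'rV[R]_m) : (0 < m)%N -> adm f1 p1 ->
  infinite_set [set c : (R -> R) * 'rV[R]_m |
    adm c.1 c.2 /\ same_outputs g f1 p1 c.1 c.2].
Proof.
move=> m_gt0 adm1 fin_choices; apply: (infinite_row_space (R := R) m_gt0).
apply: sub_finite_set (finite_image snd fin_choices) => q _.
exists (compensate g f1 p1 q, q) => //; split; first exact: adm_comp.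
exact: same_outputs_compensate.
Qed.

Lemma not_globally_identifiable (f1 : R -> R) (p1 : 'rV[R]_m) :
  adm f1 p1 -> depends_on_parameters g -> ~ globally_identifiable g adm f1 p1.
Proof.
move=> adm1 [p [q pq]] glob; apply: pq.
have g_const r : g^~ r = g^~ p1.
  apply: (compensate_eq (f1 := f1)); apply: glob; first exact: adm_comp.
  exact: same_outputs_compensate.
by rewrite !g_const.
Qed.

Lemma infinite_range_nonidentifiable (f1 : R -> R) (p1 : 'rV[R]_m) :
  adm f1 p1 -> infinite_set (range (fun p x => g x p)) ->
  nonidentifiable g adm f1 p1.
Proof.
move=> adm1 inf_g fin_alt; apply: inf_g.
(* [f1] is added to the alternatives because it is itself the compensating function whenever g(.; q)
   = g(.; p1). The map applied next undoes compensation and recovers g(.; q). *)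
have := conj fin_alt (finite_set1 f1).
rewrite -finite_setU => /(finite_image (fun f x => f1 x + g x p1 - f x)).
apply: sub_finite_set => _ [q _ <-]; exists (compensate g f1 p1 q).
  have [->|fNE] := pselect (compensate g f1 p1 q = f1); first by right.
  left; split => //; exists q; first exact: adm_comp.
  exact: same_outputs_compensate.
by apply/funext => x; rewrite /compensate subKr.
Qed.

(** Evaluation at a point where two of the functions g(.; q) differ already gives infinitely many
    values. *)
Lemma continuous_infinite_range : depends_on_parameters g ->
  (forall x, continuous (g x)) -> infinite_set (range (fun p x => g x p)).
Proof.
move=> [p [q pq]] g_cont fin_g; apply: pq; apply/funext => x; apply/eqP.
apply: contra_notT (infinite_range_continuous (v := p) (w := q) (g_cont x)) _.
move=> gpq; have := finite_image (fun h => h x) fin_g.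
by rewrite image_comp.
Qed.

Lemma not_locally_identifiable (f1 : R -> R) (p1 : 'rV[R]_m) :
  adm f1 p1 -> depends_on_parameters g -> sup_continuous_in_parameters g ->
  ~ locally_identifiable g adm f1 p1.
Proof.
move=> adm1 [p [q pq]] g_cont [eps eps0 loc].
pose A := [set r | g^~ r = g^~ p1].
(* For s near r in [A], the function compensating for s is within eps of [f1], so local
   identifiability makes it equal to [f1]. *)
have oA : open A.
  rewrite openE => r Ar; have := g_cont r (eps / 2) (divr_gt0 eps0 (ltr0Sn _ _)).
  apply: filterS => s gs; apply: (compensate_eq (f1 := f1)).
  apply: (loc _ s); first exact: adm_comp.
    exact: same_outputs_compensate.
  (* A strict pointwise bound gives only a weak bound on the supremum; halving eps restores
     strictness. *)
  apply: (@le_lt_trans _ _ (eps / 2)%:E).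
    apply: ge_ereal_sup => _ [x _ <-]; rewrite lee_fin /compensate.
    rewrite -addrA opprD addNKr opprB.
    by move/funeqP: Ar => /(_ x) <-; exact: ltW.
  by rewrite lte_fin gtr_pMr // invf_lt1 // ltr1n.
have cA : closed A.
  rewrite -[A]setCK; apply: open_closedC; rewrite openE => r Ar.
  have [x gx] : exists x, g x r != g x p1.
    apply/not_existsP => gE; apply: Ar; apply/funext => x.
    by apply/eqP/negPn/negP; exact: gE.
  (* With this distance as tolerance, no s near r can satisfy g(x; s) = g(x; p1), so a neighbourhood
     of r avoids [A]. *)
  have d0 : 0 < `|g x r - g x p1| by rewrite normr_gt0 subr_eq0.
  apply: filterS (g_cont r _ d0) => s /(_ x) + As.
  by move/funeqP: As => /(_ x) ->; rewrite distrC ltxx.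
have AT : A = setT.
  apply: (normed_module_connected (V := 'rV[R]_m)); first by exists p1.
    by exists A; rewrite ?setTI.
  by exists A; rewrite ?setTI.
have g_const r : g^~ r = g^~ p1 by rewrite -[_ = _]/(A r) AT.
by apply: pq; rewrite !g_const.
Qed.

End Compensation.

Theorem proposition3p1 (R : realType) (m : nat) (hm : (0 < m)%N)
    (g : R -> 'rV[R]_m -> R) (adm : (R -> R) -> 'rV[R]_m -> Prop) :
  (forall (f1 : R -> R) (p1 : 'rV[R]_m), adm f1 p1 ->
     forall (f2 : R -> R) (p2 : 'rV[R]_m),
       (forall x, f2 x = f1 x + g x p1 - g x p2) ->
       same_outputs g f1 p1 f2 p2)
  /\
  (compensation_closed g adm ->
   forall (f1 : R -> R) (p1 : 'rV[R]_m), adm f1 p1 ->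
     [/\ infinite_set [set c : (R -> R) * 'rV[R]_m |
           adm c.1 c.2 /\ same_outputs g f1 p1 c.1 c.2],
         depends_on_parameters g -> ~ globally_identifiable g adm f1 p1,
         infinite_set (range (fun (p : 'rV[R]_m) (x : R) => g x p)) ->
           nonidentifiable g adm f1 p1,
         depends_on_parameters g -> (forall x, continuous (g x)) ->
           nonidentifiable g adm f1 p1
       & depends_on_parameters g -> sup_continuous_in_parameters g ->
           ~ locally_identifiable g adm f1 p1]).
Proof.
split=> [f1 p1 _ f2 p2|adm_comp f1 p1 adm1].
  exact: same_outputs_compensation.
split.
- exact: infinite_choices.
- exact: not_globally_identifiable.
- exact: infinite_range_nonidentifiable.
- move=> dep_g g_cont; apply: infinite_range_nonidentifiable => //.
  exact: continuous_infinite_range.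
- exact: not_locally_identifiable.
Qed.
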